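(* Let $H$ be a reduced system (a weakly connected CBN all of whose strongly connected components are cycles of positive length), and let $x(0)$ be an initial condition of $H$, with trajectory $x(t)$, $t\ge0$. Then there exists a (positive) time step $N$, which is a multiple of the lengths of all the cycles in $H$, such that $$x(lN)=\Omega(x(0))\qquad\text{for any integer } l>0 .$$
   Context: CBN. Let $\mathbb F_2=\{0,1\}$. Digraphs are finite; self-arcs are allowed and a self-arc is a cycle of length 1. The conjunctive Boolean network (CBN) with dependency graph $H=(U,F)$ is the dynamical system on $\mathbb F_2^{|U|}$ in which, at each time step, the value of each vertex $u$ is updated synchronously to the product of the current values of all in-neighbors of $u$ (vertices $w$ with $wu\in F$). A CBN is identified with its dependency graph. Reduced digraph $H$. $H=(U,F)$ is weakly connected and its (maximal, induced) strongly connected components $H_i=(U_i,F_i)$, $i=1,\dots,q$, are all cycles of positive length. Let $\mathcal S(H)=\{H_1,\dots,H_q\}$. For distinct components write $H_i\succ H_j$ if there is a path from a vertex of $H_i$ to a vertex of $H_j$; $H_j$ is an immediate successor of $H_i$ if $H_i\succ H_j$ and there is no $H_k$ with $H_i\succ H_k\succ H_j$. Let $\mathcal S^0(H)$ be the set of maximal components (those without predecessor). Recursively, $\mathcal S^{l}(H)$ consists of the components $H_j$ that are an immediate successor of some element of $\mathcal S^{l-1}(H)$ and such that every other element of $\mathcal S^{l-1}(H)$ is either incomparable with $H_j$ or has $H_j$ as an immediate successor. Then $\mathcal S(H)=\sqcup_{l=0}^L\mathcal S^l(H)$ for some $L$, with every $\mathcal S^l(H)$, $0\le l\le L$, nonempty.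 Elementary digraphs and the map $\omega$. A weakly connected digraph $J$ is elementary if it has exactly two strongly connected components $J_-$ and $J_+$, each a cycle of positive length, and there is exactly one edge $e$ from a vertex of $J_-$ to a vertex of $J_+$ (and no other edges between them); write $J=(J_-,J_+,e)$. Let $p_-,p_+$ be the lengths of $J_-,J_+$. Label the vertices of $J_-$ as $a_0,\dots,a_{p_--1}$ with edges $a_ia_{(i+1)\bmod p_-}$, and those of $J_+$ as $b_0,\dots,b_{p_+-1}$ with edges $b_ib_{(i+1)\bmod p_+}$, so that $e=a_{p_--1}b_0$. For a state $x$ of $J$ let $x_-,x_+$ be its restrictions to $J_-,J_+$, and $x_{-,i}$, $x_{+,i}$ the values on $a_i$, $b_i$. With $N_J=\mathrm{lcm}\{p_-,p_+\}$, the state $\omega(x)$ of $J$ has restrictions $\omega_-(x):=x_-$ to $J_-$ and $\omega_+(x)$ to $J_+$, where the value of $\omega_+(x)$ on $b_i$ is $$\omega_{+,i}(x):=x_{+,i}\prod_{j=1}^{N_J/p_+}x_{-,(i-jp_+)\bmod p_-},\quad i=0,\dots,p_+-1.$$ The map $\Omega$. For states of a common cycle, $\circ$ (and $\bigcirc$ for several factors) denotes the vertex-wise product. For a state $x$ of $H$, $\Omega(x)$ is the state of $H$ whose restriction $\Omega_i(x)$ to each $H_i$ is defined by induction on $l$ where $H_i\in\mathcal S^l(H)$. If $l=0$, $\Omega_i(x):=x_{U_i}$ (the restriction of $x$ to $U_i$). If $l\ge1$, let ${\rm Elem}(H_i)$ be the (nonempty) collection of all elementary subgraphs $J=(J_-,J_+,e)$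 of $H$ with $J_+=H_i$, $J_-=H_j$ for some other component $H_j$, and $e$ an edge of $H$ from $H_j$ to $H_i$ (one such $J$ for every edge entering $H_i$ from another component; necessarily $H_j\in\mathcal S^k(H)$ with $k<l$). For $J\in{\rm Elem}(H_i)$ with $J_-=H_j$, let $x^J$ be the state of $J$ with $x^J_-:=\Omega_j(x)$ and $x^J_+:=x_{U_i}$. Then $$\Omega_i(x):=\bigcirc_{J\in{\rm Elem}(H_i)}\omega_+(x^J),$$ where $\omega_+$ is computed for each $J$ with that $J$'s own labeling. *)

(* Defs.v *)
From mathcomp Require Import all_boot all_order all_algebra.

Set Implicit Arguments.
Unset Strict Implicit.
Unset Printing Implicit Defensive.

Import GRing.Theory.
Local Open Scope ring_scope.

(* A digraph is a finite type V of vertices with an arbitrary edge relation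
   e : rel V; e u u is a self-arc at u. *)

Definition state (V : finType) := {ffun V -> 'F_2}.

Definition cbn_step (V : finType) (e : rel V) (x : state V) : state V :=
  [ffun u => \prod_(w | e w u) x w].

Definition trajectory (V : finType) (e : rel V) (x0 : state V) (t : nat) :
  state V := iter t (cbn_step e) x0.

Definition weakly_connected (V : finType) (e : rel V) : Prop :=
  forall u v : V, connect (fun y z => e y z || e z y) u v.

Definition scc_of (V : finType) (e : rel V) (u : V) : {set V} :=
  [set v | connect e u v && connect e v u].

Definition sccs (V : finType) (e : rel V) : {set {set V}} :=
  [set scc_of e u | u : V].

(* The subgraph induced by C is a cycle of positive length.  A single vertex
   qualifies exactly when it carries a self-arc. *)
Definition is_cycle (V : finType) (e : rel V) (C : {set V}) : Prop :=
  exists s : seq V,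
    [/\ (0 < size s)%N, uniq s, C = [set v in s]
      & {in C &, forall u v, e u v = (v == next s u)}].

Definition reduced (V : finType) (e : rel V) : Prop :=
  weakly_connected e /\ forall C, C \in sccs e -> is_cycle e C.

Definition scc_gt (V : finType) (e : rel V) (C D : {set V}) : bool :=
  (C != D) && [exists u in C, exists v in D, connect e u v].

Definition immediate_succ (V : finType) (e : rel V) (C D : {set V}) : bool :=
  scc_gt e C D && ~~ [exists K in sccs e, scc_gt e C K && scc_gt e K D].

Definition incomparable (V : finType) (e : rel V) (C D : {set V}) : bool :=
  ~~ scc_gt e C D && ~~ scc_gt e D C.

Fixpoint layer (V : finType) (e : rel V) (l : nat) : {set {set V}} :=
  match l with
  | 0%N => [set D in sccs e | ~~ [exists C in sccs e, scc_gt e C D]]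
  | l'.+1 =>
    [set D in sccs e |
      [exists C in layer e l',
         immediate_succ e C D &&
         [forall K in layer e l',
            (K != C) ==> incomparable e K D || immediate_succ e K D]]]
  end.

(* a = [:: a_0; ...; a_(p_- - 1)] and b = [:: b_0; ...; b_(p_+ - 1)] are the
   labelings of the two cycles of an elementary digraph J, listed along the
   edges and such that its connecting edge goes from the last vertex of a to
   the first vertex of b.  A state of J is represented by any state of V, of
   which only the values on a and b matter; omega changes the values on b
   only. *)
Definition omega (V : finType) (a b : seq V) (x : state V) : state V :=
  let pm := size a in
  let pp := size b in
  [ffun v =>
    if v \in b then
      let i := index v b in
      x v * \prod_(1 <= j < (lcmn pm pp %/ pp).+1)
              x (nth v a (absz ((i%:Z - (j * pp)%N%:Z) %% pm%:Z)%Z))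
    else x v].

(* The vertex following v on its own component, when the latter is a cycle. *)
Definition cycle_succ (V : finType) (e : rel V) (v : V) : V :=
  odflt v [pick w in scc_of e v | e v w].

(* An elementary subgraph J = (J_-, J_+, f) of a reduced digraph is encoded by
   its connecting edge f = (f.1, f.2), since J_- and J_+ are the components of
   f.1 and f.2. *)
Definition Elem (V : finType) (e : rel V) (D : {set V}) : {set V * V} :=
  [set f | [&& e f.1 f.2, f.2 \in D & f.1 \notin D]].

(* orbit (cycle_succ e) v lists the cycle through v starting from v; starting
   J_- just after f.1 makes f.1 its last vertex. *)
Definition label_minus (V : finType) (e : rel V) (f : V * V) : seq V :=
  orbit (cycle_succ e) (cycle_succ e f.1).

Definition label_plus (V : finType) (e : rel V) (f : V * V) : seq V :=
  orbit (cycle_succ e) f.2.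

(* The state x^J: given by y on J_- and by x on J_+. *)
Definition elem_state (V : finType) (e : rel V) (f : V * V) (y x : state V) :
  state V := [ffun v => if v \in scc_of e f.1 then y v else x v].

(* Omega_upto e x l agrees with Omega(x) on the components in the layers
   0, ..., l; its other values are provisional and are never read in a reduced
   digraph, since the edges entering a component of layer l + 1 from other
   components come from layers 0, ..., l. *)
Fixpoint Omega_upto (V : finType) (e : rel V) (x : state V) (l : nat) :
  state V :=
  match l with
  | 0%N => x
  | l'.+1 =>
    let y := Omega_upto e x l' in
    [ffun u =>
      if scc_of e u \in layer e l'.+1 then
        \prod_(f in Elem e (scc_of e u))
          omega (label_minus e f) (label_plus e f) (elem_state e f y x) u
      else y u]
  end.

(* There are at most #|V| components, so every layer of index at least #|V| is
   empty. *)
Definition Omega (V : finType) (e : rel V) (x : state V) : state V :=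
  Omega_upto e x #|V|.

(* Main.v *)
Require Import Defs.
From mathcomp Require Import all_boot all_order all_algebra.
From mathcomp Require Import zify.

(* A vertex u of the network is nonzero at time t iff every w with a walk of
   length exactly t to u is nonzero initially.  Take P = #|V|`!, a common
   multiple of all cycle lengths.  Every vertex lies on a cycle, hence has a
   closed walk of length P, so walks of length k P exist between the same pairs
   of vertices for all k >= #|V|: these are the pairs connected by the relation
   "there is a walk of length P".  This gives N = (#|V| + 1) P.
   The map Omega computes the product over the same set of vertices.  A walk of
   length divisible by P from w to u which starts outside the component of u
   enters that component through a unique edge f; prolonging its part before f
   along the cycle J_- to a length divisible by P reaches a vertex of J_-, and
   the vertices so obtained are exactly those read by omega at u.  Induction on
   the layer, which is the height of a component in the order of components,
   then applies to that vertex. *)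

Set Implicit Arguments.
Unset Strict Implicit.
Unset Printing Implicit Defensive.

Import GRing.Theory Num.Theory.

(** * Walks of prescribed length *)

Fixpoint walk (V : finType) (e : rel V) (n : nat) (w u : V) : bool :=
  if n is n'.+1 then [exists v, walk e n' w v && e v u] else w == u.

Lemma walkSP (V : finType) (e : rel V) (n : nat) (w u : V) :
  reflect (exists2 v, walk e n w v & e v u) (walk e n.+1 w u).
Proof.
apply: (iffP existsP) => [[v /andP[wv vu]]|[v wv vu]]; exists v => //.
exact/andP.
Qed.

Lemma walk_catP (V : finType) (e : rel V) (m n : nat) (w u : V) :
  reflect (exists2 v, walk e m w v & walk e n v u) (walk e (m + n) w u).
Proof.
elim: n u => [|n IHn] u; first rewrite addn0.
  by apply: (iffP idP) => [wu|[v wv /eqP <-] //]; exists u => /=.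
rewrite addnS; apply: (iffP (walkSP _ _ _ _)) => [[v /IHn[y wy yv] vu]|[y wy]].
  by exists y => //; apply/walkSP; exists v.
by case/walkSP=> v yv vu; exists v => //; apply/IHn; exists y.
Qed.

Lemma walk_connect (V : finType) (e : rel V) (n : nat) (w u : V) :
  walk e n w u -> connect e w u.
Proof.
elim: n u => [|n IHn] u /= => [/eqP -> //|/existsP[v /andP[/IHn wv vu]]].
exact: connect_trans wv (connect1 vu).
Qed.

Lemma walk_mul_connect (V : finType) (e : rel V) (k n : nat) (w u : V) :
  walk e (k * n) w u -> connect (walk e n) w u.
Proof.
elim: k u => [|k IHk] u; first by rewrite mul0n /= => /eqP ->.
rewrite mulSn addnC => /walk_catP[v /IHk wv vu].
exact: connect_trans wv (connect1 vu).
Qed.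

Lemma path_walk (V : finType) (e : rel V) (n : nat) (w : V) (p : seq V) :
  path (walk e n) w p -> walk e (size p * n) w (last w p).
Proof.
elim/last_ind: p => [|p v IHp]; first by rewrite /= eqxx.
rewrite rcons_path size_rcons last_rcons mulSn addnC => /andP[/IHp wp pv].
by apply/walk_catP; exists (last w p).
Qed.

(** A path of the relation [walk e n] can be shortened to fewer than [#|V|] steps, then padded to
    exactly [k] steps by closed walks of length [n] at its end. *)
Lemma connect_walk_mul (V : finType) (e : rel V) (n k : nat) (w u : V) :
  reflexive (walk e n) -> #|V| <= k ->
  connect (walk e n) w u = walk e (k * n) w u.
Proof.
move=> walk_refl leVk; apply/idP/idP; last exact: walk_mul_connect.
case/connectP=> p0 /shortenP[p wp up _] ->.
have pk: size p <= k.
  apply: leq_trans leVk; have := max_card (mem (w :: p)).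
  by rewrite (card_uniqP up) => /ltnW.
rewrite -(subnKC pk) mulnDl; apply/walk_catP.
exists (last w p); first exact: path_walk.
elim: (k - size p) => [|j IHj]; first by rewrite mul0n /=.
by rewrite mulSn; apply/walk_catP; exists (last w p); first exact: walk_refl.
Qed.

(** * Nonzero values along a trajectory *)

Lemma state_neq0_eq (V : finType) (x y : state V) :
  (forall u, (x u != 0%R) = (y u != 0%R)) -> x = y.
Proof.
move=> xy; apply/ffunP => u; move: (xy u); rewrite -!val_eqE /= => xyu.
apply/val_inj; have := ltn_ord (x u); have := ltn_ord (y u); move: xyu => /=.
by case: (nat_of_ord (x u)) (nat_of_ord (y u)) => [|[|?]] [|[|?]].
Qed.

(** Over a field a product is nonzero iff all its factors are, so each update prolongs the relevant
    walks by one last edge. *)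
Lemma trajectory_neq0 (V : finType) (e : rel V) (x : state V) n u :
  (trajectory e x n u != 0%R) = [forall w, walk e n w u ==> (x w != 0%R)].
Proof.
elim: n u => [|n IHn] u.
  apply/idP/forallP => [xu w|/(_ u)]; last by rewrite /= eqxx.
  by apply/implyP => /eqP ->.
rewrite /trajectory iterS /cbn_step ffunE -/(trajectory e x n).
apply/prodf_neq0/forallP => [xu w|xu v vu].
  apply/implyP => /walkSP[v wv vu].
  by have := xu v vu; rewrite IHn => /forallP/(_ w); rewrite wv.
rewrite IHn; apply/forallP => w; apply/implyP => wv.
by apply: (implyP (xu w)); apply/walkSP; exists v.
Qed.

(** * Heights of vertices and layers of components *)

Definition strict_anc (V : finType) (e : rel V) (v u : V) : bool :=
  connect e v u && ~~ connect e u v.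

(** The height of [u] is the largest number of strict ancestors in a chain ending at [u]. Stating
    only that it is below [l] allows a structural recursion on [l]. *)
Fixpoint height_lt (V : finType) (e : rel V) (l : nat) (u : V) : bool :=
  if l is l'.+1 then [forall v, strict_anc e v u ==> height_lt e l' v]
  else false.

Lemma strict_anc_connect (V : finType) (e : rel V) (w v u : V) :
  connect e w v -> strict_anc e v u -> strict_anc e w u.
Proof.
move=> wv /andP[vu uv]; rewrite /strict_anc (connect_trans wv vu).
by apply: contra uv => uw; apply: connect_trans wv.
Qed.

Lemma strict_anc_card (V : finType) (e : rel V) (v u : V) :
  strict_anc e v u -> #|[set w | strict_anc e w v]| < #|[set w | strict_anc e w u]|.
Proof.
move=> vu; apply: proper_card; apply/properP; split.
  apply/subsetP => w; rewrite !inE => /andP[wv _].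
  exact: strict_anc_connect wv vu.
by exists v; rewrite !inE // /strict_anc connect0.
Qed.

Lemma height_ltS (V : finType) (e : rel V) l u :
  height_lt e l u -> height_lt e l.+1 u.
Proof.
elim: l u => // l IHl u /forallP lu; apply/forallP => v.
by apply/implyP => /(implyP (lu v))/IHl.
Qed.

(** The number of strict ancestors bounds the height, and it is below [#|V|] because no vertex is
    its own strict ancestor. *)
Lemma height_lt_card (V : finType) (e : rel V) u : height_lt e #|V| u.
Proof.
suff lt_m m : forall v, #|[set w | strict_anc e w v]| < m -> height_lt e m v.
  apply: lt_m; rewrite -cardsT.
  apply: proper_card; apply/properP; split; first by apply/subsetP.
  by exists u; rewrite !inE // /strict_anc connect0.
elim: m => // m IHm v vm; apply/forallP => w; apply/implyP => /strict_anc_card.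
by move=> wv; apply: IHm; apply: leq_trans wv _.
Qed.

Lemma height_strict_anc (V : finType) (e : rel V) l v u :
  strict_anc e v u -> height_lt e l.+1 u -> height_lt e l v.
Proof. by move=> vu /forallP/(_ v); rewrite vu. Qed.

(** Some strict ancestor has height at least [l]. If its height exceeds [l], the argument is
    repeated from it, with fewer strict ancestors left. *)
Lemma height_anc (V : finType) (e : rel V) l u : ~~ height_lt e l.+1 u ->
  exists2 v, strict_anc e v u & height_lt e l.+1 v && ~~ height_lt e l v.
Proof.
have [n] := ubnP #|[set w | strict_anc e w u]|; elim: n u => // n IHn u leun.
rewrite negb_forall => /existsP[v]; rewrite negb_imply => /andP[vu lv].
have [lSv|lSv] := boolP (height_lt e l.+1 v); first by exists v; rewrite ?lSv.
have [|w wv hw] := IHn v _ lSv.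
  by apply: leq_trans (strict_anc_card vu) _.
by exists w => //; apply: strict_anc_connect vu; case/andP: wv.
Qed.

Lemma scc_of_eq (V : finType) (e : rel V) u v :
  (scc_of e u == scc_of e v) = connect e u v && connect e v u.
Proof.
apply/eqP/andP => [/setP/(_ v)|[uv vu]].
  by rewrite !inE !connect0 => /andP[].
apply/setP => w; rewrite !inE; apply/andP/andP => -[h1 h2]; split.
- exact: connect_trans vu h1.
- exact: connect_trans h2 uv.
- exact: connect_trans uv h1.
- exact: connect_trans h2 vu.
Qed.

Lemma scc_gtE (V : finType) (e : rel V) u v :
  scc_gt e (scc_of e u) (scc_of e v) = strict_anc e u v.
Proof.
rewrite /scc_gt /strict_anc scc_of_eq.
suff ->: [exists a in scc_of e u, exists b in scc_of e v, connect e a b]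
         = connect e u v by case: connect; rewrite ?andbF ?andbT.
apply/existsP/idP => [[a /andP[ua /existsP[b /andP[vb ab]]]]|uv].
  move: ua vb; rewrite !inE => /andP[ua _] /andP[_ bv].
  exact: connect_trans ua (connect_trans ab bv).
exists u; rewrite inE connect0; apply/existsP; exists v.
by rewrite inE connect0.
Qed.

Lemma mem_sccs (V : finType) (e : rel V) u : scc_of e u \in sccs e.
Proof. exact: imset_f. Qed.

Lemma immediate_succP (V : finType) (e : rel V) u v :
  reflect (strict_anc e u v /\
           forall w, strict_anc e u w -> strict_anc e w v -> False)
          (immediate_succ e (scc_of e u) (scc_of e v)).
Proof.
rewrite /immediate_succ scc_gtE; apply: (iffP andP) => -[uv h]; split=> //.
  move=> w uw wv; case/negP: h; apply/existsP; exists (scc_of e w).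
  by rewrite mem_sccs !scc_gtE uw.
apply/negP => /existsP[K /andP[/imsetP[w _ ->]]].
by rewrite !scc_gtE => /andP[/h].
Qed.

(* The recursively defined layers are the level sets of the height, the length
   of a longest chain of components above a vertex. *)
Lemma layerE (V : finType) (e : rel V) l u :
  (scc_of e u \in layer e l) = height_lt e l.+1 u && ~~ height_lt e l u.
Proof.
elim: l u => [|l IHl] u.
  rewrite /= inE mem_sccs andbT negb_exists; apply/forallP/forallP => h v.
    by have := h (scc_of e v); rewrite mem_sccs scc_gtE implybF.
  apply/negP => /andP[/imsetP[w _ ->]]; rewrite scc_gtE => wu.
  by have := h w; rewrite wu.
rewrite [layer _ _]/= inE mem_sccs andTb.
have sccP D : D \in layer e l -> exists w, D = scc_of e w.
  case: l {IHl} => [|l] /=; rewrite inE => /andP[/imsetP[w _ ->] _].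
    by exists w.
  by exists w.
apply/existsP/andP => [[C /andP[lC /andP[iCu /forallP hC]]]|[huSS huS]].
  have [c defC] := sccP _ lC; move: lC iCu hC; rewrite defC IHl.
  move=> /andP[_ hc] /immediate_succP[cu noc] hC; split; last first.
    by apply: contra hc => /(height_strict_anc cu).
  (* If [u] were higher, there would be a chain [w], [v], [u] with [w] in layer [l]. Then [w] is
     comparable with [u] but not immediately above it, so [w] lies in the component of [c]; but then
     [v] is strictly between [c] and [u]. *)
  apply/negPn/negP => /height_anc[v vu /andP[_ /height_anc[w wv hw]]].
  have wu : strict_anc e w u.
    by case/andP: wv => [wv _]; apply: strict_anc_connect vu.
  have := hC (scc_of e w); rewrite IHl hw /incomparable !scc_gtE wu /=.
  have [eqwc|_] := eqVneq; last by case/immediate_succP=> _ /(_ v wv vu).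
  move/eqP: eqwc; rewrite scc_of_eq => /andP[_ cw].
  by case: (noc v) => //; apply: strict_anc_connect wv.
(* A vertex strictly between [w] and [u] would raise the height of [u] to at least [l + 2]. *)
have imm w : ~~ height_lt e l w -> strict_anc e w u ->
    immediate_succ e (scc_of e w) (scc_of e u).
  move=> hw wu; apply/immediate_succP; split=> // v wv vu.
  by case/negP: hw; apply/(height_strict_anc wv)/(height_strict_anc vu).
have [c cu /andP[hc1 hc2]] := height_anc huS.
exists (scc_of e c); rewrite IHl hc1 hc2 imm //=; apply/forallP => K.
apply/implyP => lK; have [w defK] := sccP _ lK.
apply/implyP => _; move: lK; rewrite defK IHl => /andP[hw1 hw2].
rewrite /incomparable !scc_gtE.
have [wu|_] /= := boolP (strict_anc e w u); first exact: imm.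
apply/orP; left; apply/negP => uw; case/negP: huS.
exact/height_ltS/(height_strict_anc uw).
Qed.

(** * Motion along the cycles of a reduced digraph *)

Lemma reduced_next (V : finType) (e : rel V) (u : V) : reduced e ->
  exists2 s, uniq s /\ scc_of e u =i s &
             {in scc_of e u &, forall v w, e v w = (w == next s v)}.
Proof.
case=> _ /(_ _ (mem_sccs e u))[s [_ us def_s es]]; exists s => //.
by split=> // w; rewrite def_s inE.
Qed.

Lemma cycle_succP (V : finType) (e : rel V) (v : V) : reduced e ->
  cycle_succ e v \in scc_of e v /\ e v (cycle_succ e v).
Proof.
move=> red; have [s [us sP] es] := reduced_next v red.
have vv : v \in scc_of e v by rewrite inE connect0.
rewrite /cycle_succ; case: pickP => [w /andP[]//|/(_ (next s v))].
have nv : next s v \in scc_of e v by rewrite sP mem_next -sP.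
by rewrite nv es ?eqxx.
Qed.

Lemma edge_cycle_succ (V : finType) (e : rel V) (v w : V) : reduced e ->
  w \in scc_of e v -> e v w -> w = cycle_succ e v.
Proof.
move=> red wv vw; have [svv e_sv] := cycle_succP v red.
have [s _ es] := reduced_next v red.
have vv : v \in scc_of e v by rewrite inE connect0.
by move: vw e_sv; rewrite !es // => /eqP -> /eqP ->.
Qed.

(** A common successor puts both vertices on one cycle, where [prev] inverts [next]. *)
Lemma cycle_succ_inj (V : finType) (e : rel V) :
  reduced e -> injective (cycle_succ e).
Proof.
move=> red u v eq_uv; have [s [us sP] es] := reduced_next u red.
have [su esu] := cycle_succP u red; have [sv esv] := cycle_succP v red.
have uu : u \in scc_of e u by rewrite inE connect0.
have vu : v \in scc_of e u.
  move: su sv; rewrite eq_uv !inE => /andP[h1 h2] /andP[h3 h4].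
  by rewrite (connect_trans h1 h4) (connect_trans h3 h2).
move: esu esv; rewrite !es // -?eq_uv // => /eqP eu /eqP ev.
by rewrite -(prev_next us u) -eu ev prev_next.
Qed.

Lemma walk_iter (V : finType) (e : rel V) n v : reduced e ->
  walk e n v (iter n (cycle_succ e) v).
Proof.
move=> red; elim: n => [|n IHn] /=; first exact: eqxx.
apply/existsP; exists (iter n (cycle_succ e) v); rewrite IHn.
by case: (cycle_succP (iter n (cycle_succ e) v) red).
Qed.

(** Since its end leads back to its start, the walk stays inside one component, where every step is
    forced. *)
Lemma walk_scc (V : finType) (e : rel V) n v u : reduced e ->
  connect e u v -> walk e n v u -> u = iter n (cycle_succ e) v.
Proof.
move=> red; elim: n u => [|n IHn] u uv; first by move/eqP.
case/walkSP=> w vw wu.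
have wv : connect e w v := connect_trans (connect1 wu) uv.
rewrite iterS -(IHn w) //; apply: edge_cycle_succ => //.
by rewrite inE connect1 //= (connect_trans uv) // (walk_connect vw).
Qed.

Lemma connect_walk (V : finType) (e : rel V) v u :
  connect e v u -> exists n, walk e n v u.
Proof.
case/connectP=> p; elim/last_ind: p u => [|p w IHp] u.
  by move=> _ ->; exists 0; rewrite /= eqxx.
rewrite rcons_path last_rcons => /andP[vp pw] ->.
have [n vn] := IHp _ vp erefl.
by exists n.+1; apply/walkSP; exists (last v p).
Qed.

(** Injectivity makes orbits symmetric, which gives connection in both directions. *)
Lemma fconnect_scc (V : finType) (e : rel V) v u : reduced e ->
  fconnect (cycle_succ e) v u = (u \in scc_of e v).
Proof.
move=> red; apply/idP/idP => [uv|]; last first.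
  rewrite inE => /andP[/connect_walk[n vu] uv].
  by rewrite (walk_scc red uv vu) fconnect_iter.
have s_inj := cycle_succ_inj red.
have fe x y : fconnect (cycle_succ e) x y -> connect e x y.
  move/iter_findex <-; apply: (@walk_connect _ _ (findex _ x y)).
  exact: walk_iter.
by rewrite inE !fe // fconnect_sym.
Qed.

Lemma iter_modn_order (T : finType) (f : T -> T) m n x : injective f ->
  m = n %[mod order f x] -> iter m f x = iter n f x.
Proof.
move=> f_inj; have iter_mod k : iter k f x = iter (k %% order f x) f x.
  rewrite [in LHS](divn_eq k (order f x)) addnC iterD; congr (iter _ _ _).
  elim: (k %/ _) => [|j IHj] //; rewrite mulSn iterD IHj; exact: iter_order.
by rewrite (iter_mod m) => ->.
Qed.

Lemma iter_dvdn_order (T : finType) (f : T -> T) n x : injective f ->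
  order f x %| n -> iter n f x = x.
Proof.
move=> f_inj dvd_n; apply: (@iter_modn_order _ f n 0) => //.
by rewrite mod0n; apply/eqP.
Qed.

Lemma order_dvdn_fact (T : finType) (f : T -> T) x : order f x %| #|T|`!.
Proof. by apply: dvdn_fact; rewrite order_gt0 max_card. Qed.

Lemma walk_fact_refl (V : finType) (e : rel V) : reduced e ->
  reflexive (walk e #|V|`!).
Proof.
move=> red u; rewrite -{2}(@iter_dvdn_order _ (cycle_succ e) #|V|`! u).
- exact: walk_iter.
- exact: cycle_succ_inj.
- exact: order_dvdn_fact.
Qed.

(** * Walks entering a component, and the vertices read by [omega] *)

Lemma walk_entering (V : finType) (e : rel V) n w u :
  walk e n w u -> ~~ connect e u w ->
  exists f r s, [/\ f \in Elem e (scc_of e u), walk e s w f.1,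
                    walk e r f.2 u & n = s + r.+1].
Proof.
elim: n u => [|n IHn] u; first by move/eqP <-; rewrite connect0.
(* The last edge is the entering one unless its source [v] already lies in the component of [u]; in
   that case the walk to [v] is cut instead. *)
case/walkSP=> v wv vu uw; have [vu_conn|nuv] := boolP (connect e u v); last first.
  exists (v, u), 0, n; rewrite addn1; split=> //=.
  by rewrite !inE /= vu connect0 negb_and nuv.
have vw : ~~ connect e v w.
  by apply: (contra _ uw); apply: connect_trans vu_conn.
have [f [r [s [fE ws rv ->]]]] := IHn v wv vw.
exists f, r.+1, s; rewrite !addnS; split => //.
  suff -> : scc_of e u = scc_of e v by [].
  by apply/eqP; rewrite scc_of_eq vu_conn connect1.
by apply/walkSP; exists v.
Qed.

(** Turns the integer remainder in [omega] into a congruence of natural numbers without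
    subtraction. *)
Lemma absz_modz_sub (i d p : nat) : 0 < p ->
  let m := absz ((Posz i - Posz d)%R %% Posz p)%Z in
  m < p /\ (m + d = i %[mod p]).
Proof.
move=> p_gt0 m.
have p0 : Posz p != 0%R by rewrite eqz_nat -lt0n.
have defm : Posz m = ((Posz i - Posz d)%R %% Posz p)%Z.
  by rewrite gez0_abs // modz_ge0.
split; first by rewrite -ltz_nat defm ltz_pmod.
by apply/eqP; rewrite -eqz_nat -!modz_nat PoszD defm modzDml subrK.
Qed.

(* The vertex of J_- read by the j-th factor of omega at the vertex u of J_+. *)
Definition minus_vertex (V : finType) (e : rel V) (f : V * V) (u : V)
    (j : nat) : V :=
  nth u (label_minus e f)
    (absz ((Posz (index u (label_plus e f))
            - Posz (j * size (label_plus e f)))%R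
           %% Posz (size (label_minus e f)))%Z).

(** The labeling of J_- starts at the successor of [f.1], hence [m.+1] steps to position [m]. *)
Lemma minus_vertexE (V : finType) (e : rel V) (f : V * V) (u : V) (j : nat) :
  exists2 m, minus_vertex e f u j = iter m.+1 (cycle_succ e) f.1 &
    m + j * size (label_plus e f) = index u (label_plus e f)
      %[mod size (label_minus e f)].
Proof.
rewrite /minus_vertex; set i := index _ _; set p := size _; set q := size _.
have q_gt0 : 0 < q by rewrite /q size_orbit order_gt0.
have [] := absz_modz_sub i (j * p) q_gt0; set m := absz _ => ltmq eq_m.
exists m => //; rewrite (set_nth_default (cycle_succ e f.1)) // iterSr nth_traject //.
by rewrite -size_orbit.
Qed.

Lemma index_iter_orbit (T : finType) (f : T -> T) x n : injective f ->
  index (iter n f x) (orbit f x) = n %% order f x.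
Proof.
move=> f_inj; rewrite -[RHS](@findex_iter _ f x) ?ltn_pmod ?order_gt0 //.
by rewrite /findex; congr index; apply: iter_modn_order; rewrite ?modn_mod.
Qed.

(** The walk follows J_- for [a] steps to [f.1], crosses [f], makes [n] full turns of J_+ and then
    [i] more steps to [u]. *)
Lemma walk_minus_vertex (V : finType) (e : rel V) (f : V * V) (u : V) j :
  reduced e -> f \in Elem e (scc_of e u) ->
  connect (walk e #|V|`!) (minus_vertex e f u j) u.
Proof.
move=> red; rewrite inE => /and3P[ef f2u f1u].
have s_inj := cycle_succ_inj red.
set P := #|V|`!; set s := cycle_succ e.
have [m -> eq_m] := minus_vertexE e f u j.
set p := size (label_plus e f) in eq_m; set i := index _ _ in eq_m.
have defu : iter i s f.2 = u.
  apply: (@iter_findex _ s); rewrite fconnect_scc //.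
  by move: f2u; rewrite !inE andbC.
have defp : p = order s f.2 by rewrite /p size_orbit.
have P_gt0 : 0 < P := fact_gt0 _.
(* [n] is a natural number congruent to [-j] modulo [P], hence modulo the length of J_-. [K] is
   large enough for the length [a] left on J_- to be nonnegative. *)
pose n := j * P - j; pose K := (i + n * p).+1.
have nj : n + j = j * P by rewrite /n subnK // leq_pmulr.
have leK : i + n * p + 1 <= K * P by rewrite addn1 leq_pmulr.
pose a := K * P - (i + n * p + 1).
apply: (@walk_mul_connect _ _ K).
have -> : K * P = a + (1 + (i + n * p)) by rewrite (addnC 1) subnK.
apply/walk_catP; exists f.1; last first.
  apply/walk_catP; exists f.2; first by apply/walkSP; exists f.1 => //=.
  rewrite -[X in walk _ _ _ X]defu addnC.
  apply/walk_catP; exists (iter (n * p) s f.2); first exact: walk_iter.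
  rewrite [X in walk _ _ X]iter_dvdn_order // -?defp ?dvdn_mull //.
  exact: walk_iter.
(* The first part ends at [f.1] as soon as the length of J_- divides [a + m.+1]. *)
rewrite -[X in walk _ _ _ X](@iter_dvdn_order _ s (a + m.+1) f.1) //.
  by rewrite iterD; exact: walk_iter.
have deff : order s f.1 = size (label_minus e f).
  rewrite size_orbit; apply: eq_card => z.
  by rewrite !inE -same_fconnect1.
rewrite deff; set q := size _ in eq_m *.
have dvdqP : q %| P by rewrite /q size_orbit order_dvdn_fact.
have E : a + m.+1 + (i + j * P * p) = K * P + (m + j * p).
  by rewrite -nj /a; lia.
have /dvdnP[c defP] := dvdqP; rewrite /dvdn -[X in _ == X](mod0n q).
rewrite -(eqn_modDr (i + j * P * p)) E add0n defP mulnA modnMDl eq_m.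
by rewrite [X in _ == X %[mod q]](_ : _ = j * c * p * q + i) ?modnMDl //; lia.
Qed.

(** Replacing the part of the walk after [f.1] by steps along J_- leads to a vertex whose position
    is congruent to [r] modulo the length of J_-; a suitable [j] makes [omega] read it. *)
Lemma minus_vertex_connect (V : finType) (e : rel V) (f : V * V) (u w : V) s r :
  reduced e -> f \in Elem e (scc_of e u) ->
  walk e s w f.1 -> walk e r f.2 u -> #|V|`! %| s + r.+1 ->
  let p := size (label_plus e f) in
  exists2 j, 1 <= j < (lcmn (size (label_minus e f)) p %/ p).+1 &
             connect (walk e #|V|`!) w (minus_vertex e f u j).
Proof.
move=> red; rewrite inE => /and3P[ef f2u f1u] ws rv /dvdnP[k sr] p.
have g_inj := cycle_succ_inj red.
set P := #|V|`! in sr *; set g := cycle_succ e in g_inj.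
have P_gt0 : 0 < P := fact_gt0 _.
have defu : u = iter r g f.2.
  by apply: walk_scc rv => //; move: f2u; rewrite inE => /andP[].
have defi : index u (label_plus e f) = r %% p.
  by rewrite defu index_iter_orbit // /p size_orbit.
have deff : order g f.1 = size (label_minus e f).
  rewrite size_orbit; apply: eq_card => z.
  by rewrite !inE -same_fconnect1.
set q := size _ in deff *; set L := lcmn q p %/ p.
have q_gt0 : 0 < q by rewrite -deff order_gt0.
have p_gt0 : 0 < p by rewrite /p size_orbit order_gt0.
have defL : L * p = lcmn q p by rewrite divnK ?dvdn_lcmr.
have L_gt0 : 0 < L by rewrite divn_gt0 // dvdn_leq ?lcmn_gt0 ?q_gt0 // dvdn_lcmr.
(* [t] counts the full turns made on J_+. The witness is the representative of [-t] modulo [L] in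
   the range from 1 to [L]; as [q] divides [L * p], only [j] modulo [L] matters for [j * p] modulo
   [q]. *)
pose t := r %/ p; exists (L - t %% L).
  by rewrite subn_gt0 ltn_pmod //= ltnS leq_subr.
have [m -> eq_m] := minus_vertexE e f u (L - t %% L).
move: eq_m; rewrite -/p -/q defi => eq_m.
(* Makes the prolonged walk, of length [s + n.+1], exactly [s.+1 * P] steps long. *)
pose n := s.+1 * P - s.+1.
have nP : n + s.+1 = s.+1 * P by rewrite /n subnK // leq_pmulr.
have /dvdnP[c defP] : q %| P by rewrite -deff order_dvdn_fact.
have /dvdnP[d defd] : q %| L * p by rewrite defL dvdn_lcml.
(* Modulo [q], [m] is [r %% p + t * p = r] and [n] is [-(s + 1)]; these agree because [q] divides
   [s + r.+1]. *)
suff /eqP eq_mn : m == n %[mod q].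
  rewrite (@iter_modn_order _ _ m.+1 n.+1) //; last first.
    by apply/eqP; rewrite deff -(addn1 m) -(addn1 n) eqn_modDr; apply/eqP.
  apply: (@walk_mul_connect _ _ s.+1); rewrite -/P -nP addnS addnC -addnS.
  by rewrite -addSnnS addSnnS; apply/walk_catP; exists f.1 => //; exact: walk_iter.
rewrite -(eqn_modDr ((L - t %% L) * p)) eq_m eq_sym.
have Lt : L - t %% L + t = (t %/ L).+1 * L.
  by rewrite [in X in _ + X](divn_eq t L) addnCA subnK ?mulSn 1?addnC // ltnW ?ltn_pmod.
have E : n + (L - t %% L) * p + k * P = s.+1 * P + ((t %/ L).+1 * (L * p)) + r %% p.
  rewrite -sr -nP mulnA -Lt mulnDl; have := divn_eq r p; rewrite -/t.
  by move: (r %% p) (t * p) (_ * p) => *; lia.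
rewrite -(modnMDl (k * c)) -mulnA -defP addnC E.
by rewrite defd defP !mulnA -mulnDl modnMDl.
Qed.

Lemma minus_vertex_scc (V : finType) (e : rel V) (f : V * V) (u : V) j :
  reduced e -> minus_vertex e f u j \in scc_of e f.1.
Proof.
move=> red; have [m -> _] := minus_vertexE e f u j.
by rewrite -fconnect_scc // fconnect_iter.
Qed.

Lemma Elem_strict_anc (V : finType) (e : rel V) (f : V * V) (u v : V) :
  f \in Elem e (scc_of e u) -> v \in scc_of e f.1 -> strict_anc e v u.
Proof.
rewrite !inE => /and3P[ef /andP[_ fu] f1u] /andP[_ vf1].
have f1u_conn : connect e f.1 u := connect_trans (connect1 ef) fu.
apply: strict_anc_connect vf1 _; rewrite /strict_anc f1u_conn.
by apply: (contra _ f1u) => ->.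
Qed.

Lemma omega_elem_neq0P (V : finType) (e : rel V) (f : V * V) (y x : state V)
    (u : V) : reduced e -> f \in Elem e (scc_of e u) ->
  let p := size (label_plus e f) in
  reflect (x u != 0%R /\
           forall j, 1 <= j < (lcmn (size (label_minus e f)) p %/ p).+1 ->
             y (minus_vertex e f u j) != 0%R)
    (omega (label_minus e f) (label_plus e f) (elem_state e f y x) u != 0%R).
Proof.
move=> red fE p; have := fE; rewrite inE => /and3P[ef f2u f1u].
have u_plus : u \in label_plus e f.
  rewrite -fconnect_orbit fconnect_scc //.
  by move: f2u; rewrite !inE andbC.
have uNf1 : u \notin scc_of e f.1.
  by move: f1u; rewrite !inE andbC.
rewrite /omega ffunE u_plus mulf_eq0 negb_or ffunE (negbTE uNf1).
rewrite prodf_seq_neq0; apply: (iffP andP) => -[xu /= yj]; split=> //.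
  move=> j jL; move/allP: yj => /(_ j); rewrite mem_index_iota => /(_ jL) /=.
  by rewrite ffunE -/(minus_vertex e f u j) minus_vertex_scc.
apply/allP => j; rewrite mem_index_iota => /yj /=.
by rewrite ffunE -/(minus_vertex e f u j) minus_vertex_scc.
Qed.

(** * The map [Omega] in terms of walks, and the common period *)

Lemma Omega_upto_neq0 (V : finType) (e : rel V) (x : state V) l u :
  reduced e -> height_lt e l.+1 u ->
  (Omega_upto e x l u != 0%R) =
    [forall w, connect (walk e #|V|`!) w u ==> (x w != 0%R)].
Proof.
move=> red; set P := #|V|`!.
have walkP_refl : reflexive (walk e P) by exact: walk_fact_refl.
have walkPE w v := connect_walk_mul w v walkP_refl (leqnn _).
(* Inside a component, a walk of length divisible by [P] makes whole turns of the cycle. *)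
have walkP_scc w v : connect e v w -> connect (walk e P) w v -> w = v.
  move=> vw; rewrite walkPE => /(walk_scc red vw) ->.
  rewrite iter_dvdn_order ?dvdn_mull ?order_dvdn_fact //.
  exact: cycle_succ_inj.
(* At height 0 nothing lies above [u], so the only [w] to consider is [u] itself. *)
elim: l u => [|l IHl] u hu.
  apply/idP/forallP => [xu w|/(_ u)]; last by rewrite connect0.
  apply/implyP => wu; rewrite (walkP_scc w u) //.
  apply/negPn/negP => uw; have /forallP/(_ w) := hu.
  rewrite implybF /strict_anc uw andbT; move: wu; rewrite walkPE.
  by move/walk_connect => ->.
rewrite /Omega_upto ffunE -/(Omega_upto e x l) layerE hu.
have [hu'|hu'] := boolP (height_lt e l.+1 u); first exact: IHl.
apply/prodf_neq0/forallP => [Omega_u w|x_anc f fE]; last first.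
  apply/omega_elem_neq0P => //; split; first by have := x_anc u; rewrite connect0.
  move=> j _; rewrite IHl; last first.
    apply: height_strict_anc hu.
    exact: Elem_strict_anc fE (minus_vertex_scc _ _ _ red).
  apply/forallP => w; apply/implyP => wj; apply: (implyP (x_anc w)).
  exact: connect_trans wj (walk_minus_vertex _ red fE).
apply/implyP => wu; have [uw|uNw] := boolP (connect e u w).
  rewrite (walkP_scc w u) //.
  (* The factor [x u] occurs in every [omega], so some entering edge is required: the height of [u]
     is positive, and a walk from a strict ancestor supplies one. *)
  have [v /andP[/connect_walk[n vu] uv] _] := height_anc hu'.
  have [f [r [s [fE _ _ _]]]] := walk_entering vu uv.
  by have /(omega_elem_neq0P _ _ red fE)[] := Omega_u f fE.
have := wu; rewrite walkPE => /walk_entering/(_ uNw)[f [r [s [fE ws rv sr]]]].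
have [|j jL wj] := minus_vertex_connect red fE ws rv.
  by rewrite -sr dvdn_mull.
have /(omega_elem_neq0P _ _ red fE)[_ /(_ j jL)] := Omega_u f fE.
rewrite IHl => [/forallP/(_ w)|]; first by rewrite wj.
apply: height_strict_anc hu.
exact: Elem_strict_anc fE (minus_vertex_scc _ _ _ red).
Qed.

Theorem theorem2 (V : finType) (e : rel V) (x0 : state V) :
  reduced e ->
  exists N : nat,
    [/\ (0 < N)%N,
        forall c : seq V, c <> [::] -> ucycle e c -> (size c %| N)%N
      & forall l : nat, (0 < l)%N ->
          trajectory e x0 (l * N)%N = Omega e x0].
Proof.
(* The successor keeps [N] positive even when there are no vertices. *)
move=> red; exists (#|V|.+1 * #|V|`!); split.
- by rewrite muln_gt0 fact_gt0.
- move=> c c_nil /andP[_ uc]; apply/dvdn_mull/dvdn_fact.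
  by rewrite -(card_uniqP uc) max_card andbT (card_uniqP uc); case: c c_nil {uc}.
move=> l l_gt0; apply: state_neq0_eq => u.
rewrite trajectory_neq0 /Omega Omega_upto_neq0 //; last first.
  exact/height_ltS/height_lt_card.
(* [l * N] is a multiple of the factorial by at least [#|V|], so walks of this length realize
   exactly the connection relation. *)
apply: eq_forallb => w; rewrite mulnA -connect_walk_mul //.
  exact: walk_fact_refl.
by rewrite (leq_trans (leqnSn _)) // leq_pmull.
Qed.
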